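(* Let $C$ be the pseudo-circle. There exist continuous surjections $f,g:C\to\mathbb{S}^1$ and $\epsilon>0$ such that for no continuous map $h:C\to C$ do we have $d(f,g\circ h)<\epsilon$.
   Context: A continuum is a compact connected space. A continuum is circle-like if it is an inverse limit of spaces homeomorphic to $\mathbb{S}^1$. The pseudo-circle is R.H. Bing's pseudo-circle: the (unique up to homeomorphism) circle-like, hereditarily indecomposable continuum embeddable in the plane so as to separate it. Hereditarily indecomposable means that no subcontinuum is the union of two of its proper subcontinua. For maps $u,v:C\to\mathbb{S}^1$, $d(u,v)=\sup_{x\in C}d_{\mathbb{S}^1}(u(x),v(x))$ is the uniform distance, where $d_{\mathbb{S}^1}$ is the standard metric on $\mathbb{S}^1$. *)

(* Defs.v *)
From mathcomp Require Import all_boot all_order all_algebra.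
From mathcomp Require Import all_classical all_reals all_analysis.

Set Implicit Arguments.
Unset Strict Implicit.
Unset Printing Implicit Defensive.

Import Order.TTheory GRing.Theory Num.Theory.
Import numFieldNormedType.Exports.

Local Open Scope classical_set_scope.
Local Open Scope ring_scope.

(* Used as a type below: the coercion from sets to [set_type] gives it the
   topology induced by the product topology of the plane. *)
Definition circle (R : realType) : set (R * R) :=
  [set z | z.1 ^+ 2 + z.2 ^+ 2 = 1].
Arguments circle : clear implicits.

(* [R * R] is normed by the maximum of the coordinates in the library, hence
   the explicit Euclidean formula. *)
Definition dcircle (R : realType) (p q : circle R) : R :=
  Num.sqrt (((val p).1 - (val q).1) ^+ 2 + ((val p).2 - (val q).2) ^+ 2).

(* The family of distances is bounded by 2, so the real-valued [sup] is the
   genuine supremum as soon as [C] is nonempty. *)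
Definition dunif (R : realType) (C : Type) (u v : C -> circle R) : R :=
  sup (range (fun x => dcircle (u x) (v x))).

Definition homeomorphic (X Y : topologicalType) : Prop :=
  exists (f : X -> Y) (g : Y -> X),
    [/\ continuous f, continuous g, cancel f g & cancel g f].

Definition embedding (X Y : topologicalType) (e : X -> Y) : Prop :=
  injective e /\
  forall U : set X, open U <-> exists2 V : set Y, open V & U = e @^-1` V.

Definition inverse_limit (X : nat -> topologicalType)
    (b : forall n, X n.+1 -> X n) : set (prod_topology X) :=
  [set x | forall n, x n = b n (x n.+1)].

Definition subcontinuum (X : topologicalType) (K : set X) : Prop :=
  [/\ K !=set0, compact K & connected K].

Definition continuum (X : topologicalType) : Prop := subcontinuum [set: X].

Definition circle_like (R : realType) (X : topologicalType) : Prop :=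
  exists (Y : nat -> topologicalType) (b : forall n, Y n.+1 -> Y n),
    [/\ forall n, homeomorphic (Y n) (circle R),
        forall n, continuous (b n) &
        homeomorphic X (inverse_limit b)].

Definition hereditarily_indecomposable (X : topologicalType) : Prop :=
  ~ exists K A B : set X,
      [/\ subcontinuum K, subcontinuum A, subcontinuum B,
          A `<` K /\ B `<` K & K = A `|` B].

Definition separates_plane (R : realType) (X : topologicalType) : Prop :=
  exists2 e : X -> (R * R)%type, embedding e & ~ connected (~` range e).

Definition pseudo_circle (R : realType) (C : topologicalType) : Prop :=
  [/\ continuum C, circle_like R C, hereditarily_indecomposable C &
      separates_plane R C].

(* Main.v *)
Require Import Defs.
From mathcomp Require Import all_boot all_order all_algebra.
From mathcomp Require Import all_classical all_reals all_analysis.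
From mathcomp Require Import ring lra.

Import Order.TTheory GRing.Theory Num.Theory.
Import numFieldNormedType.Exports.

Local Open Scope classical_set_scope.
Local Open Scope ring_scope.

(** A map into the circle has an angle if it is [expi \o phi] for a continuous
    real function [phi]; then so does its composite with any map on the right.
    Take for [f] a map [C -> circle R] with no angle.  It is onto, since a map
    that misses a point of the circle has an angle.  Hence the first coordinate
    of [f] covers [[-1, 1]], and [g x = expi (pi * (f x).1)] is onto as well,
    although it has an angle by construction.  For every [h : C -> C] the map
    [g \o h] still has an angle.  If [f] were at distance less than 2, the
    diameter of the circle, from [g \o h], the two maps would be nowhere
    antipodal and [f] would have an angle too
    ([has_angle_not_antipodal]), a contradiction.

    That [C] has a map without an angle is a theorem of Borsuk on compact sets
    separating the plane ([essential_into_circle]): if [p] lies in a bounded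
    union of complementary domains of an embedded copy of [C], the direction
    from [p] to a point of the copy has no angle.  Indeed an angle extends to
    the plane by Tietze's theorem ([embedding_extension]); using the
    extended angle on the bounded side and the direction from [p] elsewhere
    would give a map from the whole plane to the circle that is the direction
    from [p] on a large circle about [p].  Shrinking that circle to [p] is a
    homotopy from a constant to the identity of the circle
    ([no_plane_extension]), while having an angle is invariant under
    homotopy ([has_angle_homotopy]) and the identity has none
    ([inclusion_no_angle]). *)

(** * Maps into the circle that have a continuous angle *)

Definition expi (R : realType) (t : R) : R * R := (cos t, sin t).
Arguments expi {R} t.

(** The half-angle formula: the argument in ]-pi, pi[ of a point of the circle
    other than (-1, 0), continuous there in one piece. *)
Definition arg (R : realType) (z : R * R) : R := atan (z.2 / (1 + z.1)) *+ 2.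
Arguments arg {R} z.

Definition has_angle (R : realType) (T : topologicalType) (u : T -> R * R) :=
  exists2 phi : T -> R, continuous phi & forall x, u x = expi (phi x).
Arguments has_angle {R T} u.

Section coordinates.
Context {T U V : topologicalType}.

Lemma continuous_fst (u : T -> U * V) :
  continuous u -> continuous (fun x => (u x).1).
Proof. by move=> cu x; apply: (cvg_comp u fst (cu x)); exact: cvg_fst. Qed.

Lemma continuous_snd (u : T -> U * V) :
  continuous u -> continuous (fun x => (u x).2).
Proof. by move=> cu x; apply: (cvg_comp u snd (cu x)); exact: cvg_snd. Qed.

Lemma continuous_pair (a : T -> U) (b : T -> V) :
  continuous a -> continuous b -> continuous (fun x => (a x, b x)).
Proof. by move=> ca cb x; exact: (cvg_pair (ca x) (cb x)). Qed.

End coordinates.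

Section angles.
Context {R : realType}.
Implicit Types (z w : R * R) (t : R).

Lemma circle_expi t : circle R (expi t).
Proof. by rewrite /circle /= cos2Dsin2. Qed.

Lemma continuous_expi : continuous (@expi R).
Proof.
by apply: continuous_pair => t; [exact: continuous_cos|exact: continuous_sin].
Qed.

Lemma circle_eqN1 z : circle R z -> 1 + z.1 = 0 -> z = (-1, 0).
Proof.
case: z => x y /= zC x0.
have xN1 : x = -1 by lra.
rewrite /circle /= xN1 in zC *; congr (_, _).
by apply/eqP; rewrite -sqrf_eq0; apply/eqP; lra.
Qed.

Lemma expi_arg z : circle R z -> z <> (-1, 0) -> expi (arg z) = z.
Proof.
move=> zC zN1; have z10 : 1 + z.1 != 0.
  by apply/eqP => z10; apply: zN1; exact: circle_eqN1.
rewrite /expi /arg; set t := z.2 / (1 + z.1).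
have cos0 : cos (atan t) != 0.
  by rewrite cos_atan invr_eq0 sqrtr_eq0 -ltNge ltr_wpDr ?sqr_ge0.
have cos2 : cos (atan t) ^+ 2 = (1 + z.1) / 2.
  rewrite cos_atan exprVn sqr_sqrtr ?addr_ge0 ?sqr_ge0//.
  have -> : 1 + t ^+ 2 = 2 / (1 + z.1).
    have y2 : z.2 ^+ 2 = (1 - z.1) * (1 + z.1).
      by move: zC; rewrite /circle /= => zC; lra.
    by rewrite /t expr_div_n y2; field.
  by rewrite invf_div.
have sincos : cos (atan t) * sin (atan t) = t * cos (atan t) ^+ 2.
  by rewrite -{3}(atanK t) /tan; field.
rewrite cos_mulr2n sin_mulr2n sincos cos2 /t [RHS]surjective_pairing.
by congr (_, _); field.
Qed.

Lemma continuous_arg {T : topologicalType} (u : T -> R * R) : continuous u ->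
  (forall x, circle R (u x)) -> (forall x, u x <> (-1, 0)) ->
  continuous (fun x => arg (u x)).
Proof.
move=> cu uC uN1 x.
have [c1 c2] := (continuous_fst _ cu x, continuous_snd _ cu x).
have ux0 : 1 + (u x).1 != 0.
  by apply/eqP => ux0; apply: (uN1 x); exact: circle_eqN1.
apply: cvgMn; apply: (@cvg_comp _ _ _ (fun x => (u x).2 / (1 + (u x).1)) atan);
  last exact: continuous_atan.
by apply: cvgM => //; apply: cvgV => //; apply: cvgD => //; exact: cvg_cst.
Qed.

(** The bound on the angle presents the circle as the image of a compact
    segment. *)
Lemma expi_surj z : circle R z -> exists2 t, t \in `[-pi, pi] & expi t = z.
Proof.
move=> zC; have [->|/eqP zN1] := eqVneq z (-1, 0).
  exists pi; last by rewrite /expi cospi sinpi.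
  by rewrite in_itv /= lexx andbT; have := @pi_gt0 R; lra.
exists (arg z); last exact: expi_arg.
rewrite in_itv /= /arg mulr2n; set t := _ / _.
by have := (atan_ltpi2 t, atan_gtNpi2 t); case=> ? ?; apply/andP; split; lra.
Qed.

(** These are the coordinates of the complex quotient of [z] by [w]. *)
Lemma circle_ratio z w : circle R z -> circle R w ->
  circle R (z.1 * w.1 + z.2 * w.2, z.2 * w.1 - z.1 * w.2).
Proof.
rewrite /circle /= => zC wC.
transitivity ((z.1 ^+ 2 + z.2 ^+ 2) * (w.1 ^+ 2 + w.2 ^+ 2)); first by ring.
by rewrite zC wC mulr1.
Qed.

(** The quotient of [u] by [v] never takes the value (-1, 0), so [arg] applies
    to it; adding the result to an angle of [v] gives an angle of [u]. *)
Lemma has_angle_not_antipodal {T : topologicalType} (u v : T -> R * R) :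
  continuous u -> continuous v ->
  (forall x, circle R (u x)) -> (forall x, circle R (v x)) ->
  (forall x, u x <> - v x) -> has_angle v -> has_angle u.
Proof.
move=> cu cv uC vC uNv [phi cphi vphi].
have [cu1 cu2] := (continuous_fst _ cu, continuous_snd _ cu).
have [cv1 cv2] := (continuous_fst _ cv, continuous_snd _ cv).
pose w x := ((u x).1 * (v x).1 + (u x).2 * (v x).2,
             (u x).2 * (v x).1 - (u x).1 * (v x).2).
have cw : continuous w.
  apply: continuous_pair => x.
  - by apply: cvgD; apply: cvgM; [exact: cu1|exact: cv1|exact: cu2|exact: cv2].
  - by apply: cvgB; apply: cvgM; [exact: cu2|exact: cv1|exact: cu1|exact: cv2].
have wC x : circle R (w x) by exact: circle_ratio.
have wN1 x : w x <> (-1, 0).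
  move=> [w1 _]; apply: (uNv x).
  move: (uC x) (vC x) w1; rewrite /circle /=.
  case: (u x) (v x) => [a b] [c d] /= ab cd w1.
  have : (a + c) ^+ 2 + (b + d) ^+ 2 = 0 by rewrite !sqrrD; lra.
  move/eqP; rewrite paddr_eq0 ?sqr_ge0// !sqrf_eq0 !addr_eq0.
  by case/andP => /eqP -> /eqP ->.
exists (fun x => phi x + arg (w x)).
  by move=> x; apply: cvgD; [exact: cphi|exact: continuous_arg].
move=> x; have [] := expi_arg _ (wC x) (wN1 x).
rewrite /expi cosD sinD => -> ->.
have := vphi x; have := vC x; rewrite /w /circle /expi /=.
case: (u x) (v x) => [a b] [c d] /= cd [<- <-].
by congr (_, _); [rewrite -[LHS]mulr1 -cd|rewrite -[LHS]mulr1 -cd]; ring.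
Qed.

Lemma has_angle_cst {T : topologicalType} z :
  circle R z -> has_angle (fun _ : T => z).
Proof.
by move=> /expi_surj[t _ <-]; exists (fun=> t) => // x; exact: cvg_cst.
Qed.

(** A map that misses [z] is nowhere antipodal to the constant [- z]. *)
Lemma has_angle_not_onto {T : topologicalType} (u : T -> R * R) z :
  continuous u -> (forall x, circle R (u x)) -> circle R z ->
  (forall x, u x <> z) -> has_angle u.
Proof.
move=> cu uC zC uz; apply: (has_angle_not_antipodal u (fun=> - z)) => //.
- by move=> x; exact: cvg_cst.
- by move=> _; rewrite /circle /= !sqrrN.
- by move=> x; rewrite opprK; exact: uz.
- by apply: has_angle_cst; rewrite /circle /= !sqrrN.
Qed.

(** By compactness of [T], maps at nearby times of the homotopy are nowhere
    antipodal, so the set of times at which an angle exists is open and so is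
    its complement; the line of times is connected. *)
Lemma has_angle_homotopy {T : topologicalType} (H : R * T -> R * R) :
  compact [set: T] -> continuous H -> (forall p, circle R (H p)) ->
  has_angle (fun x => H (0, x)) -> has_angle (fun x => H (1, x)).
Proof.
move=> cT cH HC h0.
pose S := [set s | has_angle (fun x => H (s, x))].
have cHs s : continuous (fun x => H (s, x)).
  move=> x; apply: (@cvg_comp _ _ _ (fun x => (s, x)) H); last exact: cH.
  exact: (@cvg_pair _ _ _ (nbhs x) (nbhs s) (nbhs x) _ _ _
            (fun=> s) id (cvg_cst s) cvg_id).
have near_S s : \forall s' \near s, forall x, H (s', x) <> - H (s, x).
  have near_x (x : T) :
      \forall x' \near x & s' \near s, H (s', x') <> - H (s, x').
    (* [k] vanishes exactly where the two values are antipodal, and that is a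
       closed condition. *)
    pose k (p : T * R) := H (p.2, p.1) + H (s, p.1).
    have ck : k p @[p --> (x, s)] --> k (x, s).
      apply: (@cvgD _ _ _ _ _ (fun p => H (p.2, p.1)) (fun p => H (s, p.1)));
        last first.
        apply: (@cvg_comp _ _ _ fst (fun x => H (s, x))); first exact: cvg_fst.
        exact: cHs.
      apply: (@cvg_comp _ _ _ (fun p => (p.2, p.1)) H); last exact: cH.
      exact: (cvg_pair cvg_snd cvg_fst).
    have k0 : k (x, s) != 0.
      rewrite /k /= -mulr2n -scaler_nat scaler_eq0 pnatr_eq0 /=.
      apply/eqP => Hsx; have := HC (s, x).
      by rewrite Hsx /circle /= expr0n /= addr0 => /esym/eqP; rewrite oner_eq0.
    have : \forall p \near (x, s), k p != 0.
      apply: (ck [set w | w != 0]); apply: open_nbhs_nbhs; split => //.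
      have -> : [set w : R * R | w != 0] = ~` [set 0].
        by apply/seteqP; split => w /= /eqP.
      rewrite openC; apply: accessible_closed_set1.
      exact/hausdorff_accessible/norm_hausdorff.
    apply: filterS => -[x' s'] /= kp /eqP; rewrite -addr_eq0; exact/negP.
  pose P s' x := H (s', x) <> - H (s, x).
  move/compact_near_coveringP: cT => /(_ _ (nbhs s) P _ (fun x _ => near_x x)).
  by apply: filterS => s' h x; exact: h.
have SC s s' : (forall x, H (s', x) <> - H (s, x)) -> S s <-> S s'.
  move=> ss'; split; apply: has_angle_not_antipodal => // x; last first.
    by move/esym/(congr1 -%R); rewrite opprK => /esym h; exact: (ss' x).
have oS (A : set R) :
    (forall s s', (forall x, H (s', x) <> - H (s, x)) -> A s -> A s') -> open A.
  by rewrite openE => AS s As /=; apply: filterS (near_S s) => s' /AS; exact.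
have S1 : S = setT.
  have cR : connected [set: R] by apply/connected_intervalP.
  apply: cR; first by exists 0.
  - exists S; last by rewrite setTI.
    by apply: oS => s s' /SC [].
  - exists S; last by rewrite setTI.
    rewrite -openC; apply: oS => s s' /SC [_ S's] nS; exact: (contra_not S's).
by have : S 1 by rewrite S1.
Qed.

End angles.

(** * The round circle *)

Section round_circle.
Context {R : realType}.
Implicit Types (z : R * R) (t : R).

Definition to_circle {z} (zC : circle R z) : circle R :=
  exist _ z (mem_set zC).

Lemma circle_val (z : circle R) : circle R (val z).
Proof. by case: z => z /= /set_mem. Qed.

Lemma continuous_val : continuous (fun z : circle R => val z).
Proof. exact: initial_continuous. Qed.

Lemma continuous_to_circle {T : topologicalType} (u : T -> R * R)
    (uC : forall x, circle R (u x)) :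
  continuous u -> continuous (fun x => to_circle (uC x)).
Proof. by move=> cu; exact: (@continuous_comp_initial _ _ _ set_val). Qed.

Let wrap t : circle R := to_circle (circle_expi t).

Let continuous_wrap : continuous wrap.
Proof. exact/continuous_to_circle/continuous_expi. Qed.

Lemma compact_circle : compact [set: circle R].
Proof.
have -> : [set: circle R] = wrap @` `[-pi, pi].
  apply/esym/seteqP; split => // z _.
  have [t tpi tz] := expi_surj _ (circle_val z).
  by exists t => //; exact: val_inj.
apply: continuous_compact; last exact: segment_compact.
exact: continuous_subspaceT.
Qed.

(** An angle [phi] of the identity, read along [t |-> expi t] and diminished by
    [t], takes values in the multiples of [2 pi] only.  It drops by [2 pi] over
    one turn, so the intermediate value theorem gives a forbidden value. *)
Lemma inclusion_no_angle : ~ has_angle (fun z : circle R => val z).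
Proof.
move=> [phi cphi phiE].
pose psi (t : R) : R := phi (wrap t) - t.
have cpsi : continuous psi.
  move=> t; apply: cvgB; last exact: cvg_id.
  by apply: (@cvg_comp _ _ _ wrap phi); [exact: continuous_wrap|exact: cphi].
have psi0 t : cos (psi t) = 1.
  have [ct st] : expi t = expi (phi (wrap t)) by rewrite -phiE.
  by rewrite /psi cosB -ct -st -!expr2 cos2Dsin2.
have wrap2 : wrap (pi *+ 2) = wrap 0.
  by apply: val_inj; rewrite /= /expi cos2pi sin2pi cos0 sin0.
have pi0 := @pi_gt0 R.
have [|||t _ psit] := @IVT R psi 0 (pi *+ 2) (psi 0 - pi).
- by rewrite mulr2n; lra.
- exact: continuous_subspaceT.
- have -> : psi (pi *+ 2) = psi 0 - pi *+ 2 by rewrite /psi wrap2 subr0.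
  rewrite ge_min le_max mulr2n; apply/andP; split; apply/orP.
    by right; lra.
  by left; lra.
have := psi0 t; rewrite psit -cosN opprB -[pi - _]addrC cosDpi cosN psi0.
lra.
Qed.

(** The circles of centre [p] and radius [s rho], for [s] from 0 to 1, make [F]
    a homotopy from a constant to the identity of the circle. *)
Lemma no_plane_extension (F : R * R -> R * R) (p : R * R) (rho : R) :
  continuous F -> (forall x, circle R (F x)) ->
  (forall z, circle R z -> F (p + rho *: z) = z) -> False.
Proof.
move=> cF FC Fz; apply: inclusion_no_angle.
pose H (q : R * circle R) := F (p + (q.1 * rho) *: val q.2).
have cH : continuous H.
  move=> q; apply: (@cvg_comp _ _ _ (fun q => p + (q.1 * rho) *: val q.2) F);
    last exact: cF.
  apply: cvgD; first exact: cvg_cst.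
  apply: cvgZ.
    apply: cvgM; last exact: cvg_cst.
    by apply: (continuous_fst id) => r; exact: cvg_id.
  apply: (@cvg_comp _ _ _ snd (fun z : circle R => val z));
    last exact: continuous_val.
  by apply: (continuous_snd id) => r; exact: cvg_id.
have := has_angle_homotopy H compact_circle cH (fun=> FC _).
rewrite /H /=.
have -> : (fun z : circle R => F (p + (0 * rho) *: \val z)) = fun=> F p.
  by apply/funext => z; rewrite mul0r scale0r addr0.
have -> : (fun z : circle R => F (p + (1 * rho) *: \val z)) =
          fun z : circle R => val z.
  by apply/funext => z; rewrite mul1r Fz//; exact: circle_val.
by apply; exact: has_angle_cst.
Qed.

End round_circle.

(** * Complementary domains of a bounded set in the plane *)

Section planar_sides.
Context {R : realType}.

(** The part of the segment in [U] is open and closed in it, and the segment is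
    connected. *)
Lemma segment_same_side (U W : set (R * R)) (a b : R * R) :
  open U -> open W -> U `&` W = set0 ->
  (forall t, 0 <= t <= 1 -> (U `|` W) (a + t *: (b - a))) -> U a -> U b.
Proof.
move=> oU oW UW seg Ua; pose gam t := a + t *: (b - a).
have cgam : continuous gam.
  by move=> t; apply: cvgD; [exact: cvg_cst|exact: cvgZr_tmp].
suff -> : b = gam 1.
  have /seteqP[_ /(_ 1)] : `[0, 1]%classic `&` gam @^-1` U = `[0, 1]%classic.
    apply: segment_connected.
    - exists 0; split; first by rewrite /= in_itv /= lexx ler01.
      by rewrite /= /gam scale0r addr0.
    - by exists (gam @^-1` U) => //; apply: open_comp => // t _; exact: cgam.
    - exists (gam @^-1` (~` W)).
        apply: preimage_closed; last exact: open_closedC.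
        by move=> t _; exact: cgam.
      apply/seteqP; split => t [t01 h]; split => //.
        by move=> Wt; have : (U `&` W) (gam t) by []; rewrite UW.
      by have := seg t; rewrite /= in_itv /= in t01; case/(_ t01).
  by case=> //; rewrite /= in_itv /= lexx ler01.
by rewrite /gam scale1r addrC subrK.
Qed.

Definition box (M : R) : set (R * R) := [set x | `|x.1| <= M /\ `|x.2| <= M].

(** The exterior of the box is the union of four open half-planes.  From any of
    its points, one or two segments, each inside one half-plane, lead to the
    corner [(M + 1, M + 1)], which is thus on the same side. *)
Lemma exterior_same_side (U W : set (R * R)) (M : R) : 0 <= M ->
  open U -> open W -> U `&` W = set0 -> ~` box M `<=` U `|` W ->
  W (M + 1, M + 1) -> U `<=` box M.
Proof.
move=> M0 oU oW UW ext Wc x Ux.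
pose c : R * R := (M + 1, M + 1).
have Uc : ~ U c by move=> Uc; have : (U `&` W) c by []; rewrite UW.
have side (u : R * R -> R) a b :
    (forall t, u (a + t *: (b - a)) = u a + t * (u b - u a)) ->
    (forall y, M < u y -> ~ box M y) -> M < u a -> M < u b -> U a -> U b.
  move=> ulin ubox ua ub; apply: (segment_same_side U W) => // t /andP[t0 t1].
  apply/ext/ubox; rewrite ulin; have [uab|uba] := leP (u a) (u b).
    by have := mulr_ge0 t0 (_ : 0 <= u b - u a); lra.
  by have := mulr_ge0 (_ : 0 <= 1 - t) (_ : 0 <= u a - u b); lra.
have right a b : M < a.1 -> M < b.1 -> U a -> U b.
  apply: (side fst) => // y My.
  by rewrite /box /= !ler_norml => -[/andP[]]; lra.
have top a b : M < a.2 -> M < b.2 -> U a -> U b.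
  apply: (side snd) => // y My.
  by rewrite /box /= !ler_norml => -[_ /andP[]]; lra.
have left a b : M < - a.1 -> M < - b.1 -> U a -> U b.
  apply: (side (fun y => - y.1)) => [t|y My].
    by rewrite -[LHS]/(- (a.1 + t * (b.1 - a.1))); ring.
  by rewrite /box /= !ler_norml => -[/andP[]]; lra.
have bottom a b : M < - a.2 -> M < - b.2 -> U a -> U b.
  apply: (side (fun y => - y.2)) => [t|y My].
    by rewrite -[LHS]/(- (a.2 + t * (b.2 - a.2))); ring.
  by rewrite /box /= !ler_norml => -[_ /andP[]]; lra.
split; rewrite leNgt; apply/negP; rewrite ltr_normr => /orP[] xM; apply: Uc.
- by apply: right xM _ Ux => /=; lra.
- apply: (top (- M - 1, M + 1)) => /=; try lra.
  by apply: left xM _ Ux => /=; lra.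
- by apply: top xM _ Ux => /=; lra.
- apply: (right (M + 1, - M - 1)) => /=; try lra.
  by apply: bottom xM _ Ux => /=; lra.
Qed.

End planar_sides.

(** * Plane separators carry an essential map to the circle *)

Section plane_separators.
Context {R : realType}.
Implicit Types (z : R * R).

Lemma embedding_continuous (X Y : topologicalType) (e : X -> Y) :
  embedding e -> continuous e.
Proof.
by move=> [_ openE]; apply/continuousP => A oA; apply/openE; exists A.
Qed.

(** Tietze's theorem, transported along an embedding of a compact space. *)
Lemma embedding_extension (X : topologicalType) (Y : pseudoMetricType R)
    (e : X -> Y) (phi : X -> R) :
  hausdorff_space Y -> compact [set: X] -> embedding e -> continuous phi ->
  exists2 psi : Y -> R, continuous psi & forall x, psi (e x) = phi x.
Proof.
move=> hY cX emb cphi; have ce := embedding_continuous _ _ _ emb.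
case: emb => injE openE.
have clE : closed (range e).
  apply: compact_closed => //; apply: continuous_compact => //.
  exact: continuous_subspaceT.
have [g gE] : exists g : Y -> R, forall x, g (e x) = phi x.
  exists (fun y => if pselect (exists x, e x = y) is left h
                   then phi (projT1 (cid h)) else 0) => x.
  case: pselect => [h|]; last by case; exists x.
  by case: cid => x' /= /injE ->.
have [M M0 Mphi] : exists2 M, 0 < M & forall x, `|phi x| <= M.
  have /compact_bounded[M [_ Mphi]] : compact (range phi).
    by apply: continuous_compact => //; exact: continuous_subspaceT.
  exists (`|M| + 1) => [|x]; first by rewrite ltr_wpDl.
  by apply: (Mphi (`|M| + 1)); [rewrite ltr_pwDr// ler_norm|exists x].
have cg : {within range e, continuous g}.
  apply/continuousP => A oA; apply/open_subspaceP.
  have [V oV phiA] : exists2 V, open V & phi @^-1` A = e @^-1` V.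
    by apply/openE; exact: (proj1 (continuousP _) cphi).
  exists V => //; apply/seteqP.
  have AV x : A (g (e x)) <-> V (e x).
    by rewrite gE (congr1 (fun B => B x) phiA : A (phi x) = V (e x)).
  split => y [+ [x _ xy]]; rewrite -{}xy => h; split=> //.
  - exact: (proj2 (AV x)).
  - exact: (proj1 (AV x)).
have [|psi [gpsi cpsi _]] :=
  continuous_bounded_extension pseudometric_normal clE M0 cg.
  by move=> _ [x _ <-]; rewrite gE.
by exists psi => // x; rewrite -gE gpsi//; apply/mem_set; exists x.
Qed.

Definition radius (x : R * R) : R := Num.sqrt (x.1 ^+ 2 + x.2 ^+ 2).

Definition direction (p x : R * R) : R * R := (radius (x - p))^-1 *: (x - p).

Lemma radius_gt0 z : z != 0 -> 0 < radius z.
Proof.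
case: z => a b ab0; rewrite sqrtr_gt0 lt_neqAle addr_ge0 ?sqr_ge0// andbT.
apply: contra ab0; rewrite eq_sym paddr_eq0 ?sqr_ge0// !sqrf_eq0 /=.
by case/andP => /eqP -> /eqP ->.
Qed.

Lemma circle_direction p x : x != p -> circle R (direction p x).
Proof.
rewrite -subr_eq0 /direction => xp0; have r0 := radius_gt0 _ xp0.
have : radius (x - p) ^+ 2 = (x - p).1 ^+ 2 + (x - p).2 ^+ 2.
  by rewrite sqr_sqrtr// addr_ge0 ?sqr_ge0.
set r := radius _ in r0 * => r2.
change ((r^-1 * (x - p).1) ^+ 2 + (r^-1 * (x - p).2) ^+ 2 = 1).
by rewrite !exprMn -mulrDr -r2 -exprMn mulVf ?expr1n// gt_eqF.
Qed.

Lemma continuous_direction p x : x != p -> {for x, continuous (direction p)}.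
Proof.
rewrite -subr_eq0 => xp0.
have cx : (fun y : R * R => y - p) y @[y --> x] --> x - p.
  by apply: cvgB; [exact: cvg_id|exact: cvg_cst].
apply: cvgZ => //; apply: cvgV; first by rewrite gt_eqF// radius_gt0.
apply: (@cvg_comp _ _ _ (fun y => (y - p).1 ^+ 2 + (y - p).2 ^+ 2) Num.sqrt);
  last exact: sqrt_continuous.
have [c1 c2] := (cvg_comp _ fst cx cvg_fst, cvg_comp _ snd cx cvg_snd).
by apply: cvgD; [exact: (cvgM c1 c1)|exact: (cvgM c2 c2)].
Qed.

Lemma direction_ray p rho z : 0 < rho -> circle R z ->
  direction p (p + rho *: z) = z.
Proof.
move=> rho0 zC; rewrite /direction addrC addKr.
have -> : radius (rho *: z) = rho.
  rewrite /radius -[X in Num.sqrt X]/((rho * z.1) ^+ 2 + (rho * z.2) ^+ 2).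
  by rewrite !exprMn -mulrDr zC mulr1 sqrtr_sqr gtr0_norm.
by rewrite scalerA mulVf ?scale1r// gt_eqF.
Qed.

(** If there were an angle, gluing its extension on [U] to the direction from
    [p] off [U] would contradict [no_plane_extension].  The pieces agree on the
    image of [e], the overlap of the closed sets [~` W] and [~` U]. *)
Lemma direction_no_angle (X : topologicalType) (e : X -> R * R)
    (U W : set (R * R)) (M : R) (p : R * R) :
  compact [set: X] -> embedding e -> open U -> open W -> U `&` W = set0 ->
  ~` range e = U `|` W -> U `<=` box M -> U p ->
  ~ has_angle (fun x => direction p (e x)).
Proof.
move=> cX emb oU oW UW eUW UM Up [phi cphi phiE].
have [psi cpsi psiE] :=
  embedding_extension _ _ _ _ (@norm_hausdorff _ _) cX emb cphi.
pose F x := if x \in U then expi (psi x) else direction p x.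
have nUp x : ~ U x -> x != p.
  by move=> nUx; apply/eqP => xp; apply: nUx; rewrite xp.
have FW : {in ~` W, F =1 expi \o psi}.
  move=> x /set_mem nWx; rewrite /F; case: ifPn => // /negP nUx.
  have [c _ <-] : range e x.
    apply: contrapT; change (~ (~` range e) x); rewrite eUW => -[Ux|//].
    exact/nUx/mem_set.
  by rewrite phiE /= psiE.
have FU : {in ~` U, F =1 direction p}.
  by move=> x /set_mem nUx; rewrite /F ifN//; apply/negP => /set_mem.
have cF : continuous F.
  apply/continuous_subspace_setT.
  have <- : ~` W `|` ~` U = setT by rewrite -setCI setIC UW setC0.
  apply: withinU_continuous; rewrite ?closedC//.
  - apply: (subspace_eq_continuous (f := expi \o psi)).
      by move=> x xW; exact/esym/FW.
    apply: continuous_subspaceT => x.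
    by apply: continuous_comp; [exact: cpsi|exact: continuous_expi].
  - apply: (subspace_eq_continuous (f := direction p)).
      by move=> x xU; exact/esym/FU.
    apply/subspace_continuousP => x nUx; apply: cvg_within_filter.
    exact/continuous_direction/nUp.
have FC x : circle R (F x).
  rewrite /F; case: ifPn => [_|/negP Ux]; first exact: circle_expi.
  by apply/circle_direction/nUp => /mem_set.
(* The circle of radius [rho] about [p] is outside the box, hence off [U]. *)
pose rho := (`|M| + `|p.1| + `|p.2| + 1) *+ 2.
have rho0 : 0 < rho by rewrite /rho mulrn_wgt0// ltr_wpDl// !addr_ge0.
apply: (no_plane_extension F p rho cF FC) => z zC.
rewrite FU ?direction_ray//; apply/mem_set => /UM.
case=> [h1 h2]; move: zC; rewrite /circle /= => zC.
have far (a b : R) : `|a + rho * b| <= M -> rho * `|b| <= `|M| + `|a|.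
  move=> ab; have -> : rho * `|b| = `|(a + rho * b) - a|.
    by rewrite addrC addKr normrM gtr0_norm.
  by rewrite (le_trans (ler_normB _ _))// lerD2r (le_trans ab)// ler_norm.
have [b1 b2] := (far _ _ h1, far _ _ h2).
have n1 : `|z.1| ^+ 2 = z.1 ^+ 2 by rewrite -normrX ger0_norm ?sqr_ge0.
have n2 : `|z.2| ^+ 2 = z.2 ^+ 2 by rewrite -normrX ger0_norm ?sqr_ge0.
have : 1 <= `|z.1| + `|z.2|.
  have [z1 z2] := (normr_ge0 z.1, normr_ge0 z.2); nra.
rewrite -(ler_pM2l rho0) mulr1 mulrDr => h.
have := le_trans h (lerD b1 b2); rewrite {1}/rho mulr2n.
by have := normr_ge0 M; have := normr_ge0 p.1; have := normr_ge0 p.2; lra.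
Qed.

(** A separation of the complement has two open sides, and the exterior of a
    box around the image lies in one of them; the direction from a point of the
    other side has no angle. *)
Lemma essential_into_circle (X : topologicalType) :
  compact [set: X] -> separates_plane R X ->
  exists2 u : X -> R * R,
    continuous u /\ (forall x, circle R (u x)) & ~ has_angle u.
Proof.
move=> cX [e emb disc]; have ce := embedding_continuous _ _ _ emb.
have cK : compact (range e).
  by apply: continuous_compact => //; exact: continuous_subspaceT.
have [U [W [[oU oW] [UW eUW] [[p Up] [q Wq]]]]] : exists U W : set (R * R),
    [/\ open U /\ open W, U `&` W = set0 /\ ~` range e = U `|` W &
        U !=set0 /\ W !=set0].
  have oV : open (~` range e).
    by rewrite openC; apply: compact_closed => //; exact: norm_hausdorff.
  apply: contrapT => noUW; apply: disc => A A0 [G oG AG] [D cD AD].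
  apply: contrapT => AV; apply: noUW; exists A, (~` range e `&` ~` D).
  split; split.
  - by rewrite AG; exact: openI.
  - by apply: openI => //; exact: closed_openC.
  - by rewrite {1}AD; apply/seteqP; split => // x [[_ Dx] [_ /(_ Dx)]].
  - by rewrite {1}AD -setIUr setUv setIT.
  - by [].
  - apply/set0P/eqP => W0; apply: AV; rewrite AD; apply/seteqP.
    split=> x; first by case.
    move=> Vx; split => //; apply: contrapT => nDx.
    by have : set0 x by rewrite -W0.
have [M M0 KM] : exists2 M, 0 <= M & range e `<=` box M.
  have [M [_ KM]] := compact_bounded cK.
  exists (`|M| + 1) => [|x Kx]; first exact: addr_ge0.
  have : `|x| <= `|M| + 1.
    by apply: (KM (`|M| + 1)) => //; rewrite ltr_pwDr// ler_norm.
  by rewrite prod_normE ge_max => /andP[].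
have ext : ~` box M `<=` U `|` W by rewrite -eUW; exact: subsetC.
have essential (U' W' : set (R * R)) p' : open U' -> open W' ->
    U' `&` W' = set0 -> ~` range e = U' `|` W' -> U' p' -> W' (M + 1, M + 1) ->
    exists2 u : X -> R * R,
      continuous u /\ (forall x, circle R (u x)) & ~ has_angle u.
  move=> oU' oW' UW' eUW' Up' Wc.
  have ep x : e x != p'.
    apply/eqP => exp; have : (~` range e) p' by rewrite eUW'; left.
    by case; exists x.
  exists (fun x => direction p' (e x)).
    split=> x; last exact: circle_direction.
    apply: (@cvg_comp _ _ _ e (direction p')); first exact: ce.
    exact: continuous_direction.
  apply: (direction_no_angle _ _ U' W' M) => //.
  by apply: (exterior_same_side U' W') => //; rewrite -eUW' eUW.
have : (U `|` W) (M + 1, M + 1).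
  apply: ext => -[/= h _]; move: h; rewrite ger0_norm; lra.
case=> [Uc|Wc]; last exact: (essential U W p).
by apply: (essential W U q) => //; rewrite 1?setIC 1?setUC.
Qed.

End plane_separators.

(** * Maps that are uniformly close *)

Lemma dcircle_le2 (R : realType) (p q : circle R) : dcircle p q <= 2.
Proof.
case: p q => [[a b] pC] [[c d] qC].
have ab := set_mem pC; have cd := set_mem qC.
rewrite /circle /= in ab cd; rewrite /dcircle /=.
rewrite -[2]gtr0_norm// -sqrtr_sqr ler_sqrt ?sqr_ge0//.
have := sqr_ge0 (a + c); have := sqr_ge0 (b + d); nra.
Qed.

(** Antipodal points are at distance 2, and the supremum is at least each of the
    distances because these are bounded. *)
Lemma dunif_not_antipodal (R : realType) (C : Type) (u v : C -> circle R) :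
  dunif u v < 2 -> forall x, val (u x) <> - val (v x).
Proof.
move=> uv2 x uNv; move: uv2; apply/negP; rewrite -leNgt.
have -> : 2 = dcircle (u x) (v x) :> R.
  rewrite /dcircle uNv; have := circle_val (v x); rewrite /circle /=.
  case: (val (v x)) => [a b] /= ab.
  have -> : (- a - a) ^+ 2 + (- b - b) ^+ 2 = 2 ^+ 2 :> R.
    transitivity ((2 : R) ^+ 2 * (a ^+ 2 + b ^+ 2)); first by ring.
    by rewrite ab mulr1.
  by rewrite sqrtr_sqr gtr0_norm.
apply: ub_le_sup; last by exists x.
by exists 2 => _ [y _ <-]; exact: dcircle_le2.
Qed.

Theorem theorem1p7 (R : realType) (C : topologicalType)
    (hC : pseudo_circle R C) :
  exists (f g : C -> circle R) (eps : R),
    [/\ continuous f /\ range f = [set: circle R],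
        continuous g /\ range g = [set: circle R],
        0 < eps &
        ~ exists h : C -> C, continuous h /\ dunif f (g \o h) < eps].
Proof.
have [[_ cC _] _ _ sepC] := hC.
have [u [cu uC] noangle] := essential_into_circle C cC sepC.
have onto z : circle R z -> exists x, u x = z.
  move=> zC; apply: contrapT => noz; apply: noangle.
  by apply: (has_angle_not_onto u z) => // x uxz; apply: noz; exists x.
pose phi x : R := (u x).1 * pi.
have cphi : continuous phi.
  by move=> x; apply: cvgM; [exact: (continuous_fst _ cu)|exact: cvg_cst].
pose f x := to_circle (uC x).
pose g x := to_circle (circle_expi (phi x)).
have cg : continuous g.
  apply: continuous_to_circle => x.
  by apply: (@cvg_comp _ _ _ phi expi); [exact: cphi|exact: continuous_expi].
exists f, g, 2; split => //.
- split; first exact: continuous_to_circle.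
  apply/seteqP; split => // z _; have [x uxz] := onto _ (circle_val z).
  by exists x => //; exact: val_inj.
- split=> //; apply/seteqP; split => // z _.
  have [t tpi tz] := expi_surj _ (circle_val z).
  have pi0 := @pi_gt0 R.
  have t1 : (t / pi) ^+ 2 <= 1.
    move: tpi; rewrite in_itv /= => /andP[tl tr].
    by rewrite -(ger0_norm (sqr_ge0 _)) normrX expr_le1// normrM normfV
      (gtr0_norm pi0) ler_pdivrMr// mul1r ler_norml tl.
  have [|x ux] := onto (t / pi, Num.sqrt (1 - (t / pi) ^+ 2)).
    by rewrite /circle /= sqr_sqrtr ?subr_ge0// addrC subrK.
  exists x => //; apply: val_inj.
  by rewrite /= /phi ux /= divfK ?gt_eqF.
- move=> [h [ch fgh]]; apply: noangle.
  apply: (has_angle_not_antipodal u (fun x => val (g (h x)))) => //.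
  + move=> x; apply: (@cvg_comp _ _ _ (g \o h) (fun z : circle R => val z)).
      by apply: continuous_comp; [exact: ch|exact: cg].
    exact: continuous_val.
  + by move=> x; exact: circle_val.
  + exact: (dunif_not_antipodal _ _ _ _ fgh).
  + exists (phi \o h) => // x.
    by apply: continuous_comp; [exact: ch|exact: cphi].
Qed.
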